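(* Consider the reversible jump MCMC algorithm described in the context. Suppose that the mechanisms producing $s$ and $n_{\mathrm{dp}}$ satisfy $\epsilon_s$-DP and $\epsilon_n$-DP, respectively, in the unbounded sense. Then: 1) the within-model acceptance probability $\min\{1,\,p(s\mid x^* )/p(s\mid x)\}$ is lower bounded by $\exp(-2\epsilon_s)$; 2) if $p(n)$ is a flat (improper) prior, then the between-models acceptance probability $$\min\left\{1,\frac{p(n^* )\,p(s\mid x^* )\,p(n_{\mathrm{dp}}\mid n^* )\,q(n\mid n^* )}{p(n)\,p(s\mid x)\,p(n_{\mathrm{dp}}\mid n)\,q(n^*\mid n)}\right\}$$ is lower bounded by $\exp(-(\epsilon_s+\epsilon_n))$ for all $n\ge2$; if $n=1$ and $n^*=2$, then the lower bound is instead $\tfrac12\exp(-(\epsilon_s+\epsilon_n))$.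
   Context: Datasets are finite sequences $x=(x_1,\dots,x_n)\in\bigcup_{n\ge1}\mathcal{X}_1^n$. In unbounded DP, two datasets are neighbors if they differ by the addition or removal of one entry. A mechanism $M$ is $\epsilon$-DP if $P(M(x)\in S)\le e^{\epsilon}P(M(x')\in S)$ for all neighboring $x,x'$ and measurable $S$; for mechanisms with densities, the densities are understood to satisfy $p(s\mid x)\le e^{\epsilon}p(s\mid x')$ for neighboring $x,x'$. The mechanism $p(n_{\mathrm{dp}}\mid n)$ depends on the dataset only through its size $n$, so $\epsilon_n$-DP means $p(n_{\mathrm{dp}}\mid n)\le e^{\epsilon_n}p(n_{\mathrm{dp}}\mid n')$ whenever $|n-n'|=1$. Model: prior $p(\theta)$, prior $p(n)$ on $\{1,2,\dots\}$, $x_1,\dots,x_n$ i.i.d. from $p(\cdot\mid\theta)$ given $(\theta,n)$, $s\sim p(s\mid x_{1:n})$, $n_{\mathrm{dp}}\sim p(n_{\mathrm{dp}}\mid n)$. The mechanism for $s$ is record-additive: $p(s\mid x_{1:n})=g(s,\sum_{i=1}^nt(s,x_i))$ for known functions $g,t$. One iteration of the algorithm from state $(\theta,x_{1:n},n)$, with $(s,n_{\mathrm{dp}})$ fixed: 1. Within-model moves: (a) draw $\theta\sim p(\theta\mid x_{1:n})$. (b) For $i=1,\dots,n$ sequentially: propose $x_i^*\sim p(\cdot\mid\theta)$, let $x^*$ be $x$ with $x_i$ replaced by $x_i^*$, and accept (set $x=x^*$) with probability $\min\{1,p(s\mid x^* )/p(s\mid x)\}$. 2. Between-models move: draw $n^*$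 from $q(n^*\mid n)$, where $q(2\mid1)=1$; $q(n\pm1\mid n)=1/2$ for $n>1$; and $q=0$ otherwise. If $n^*=n+1$, draw $x_{n+1}^*\sim p(\cdot\mid\theta)$ and set $x^*=(x_1,\dots,x_n,x_{n+1}^* )$; if $n^*=n-1$, set $x^*=(x_1,\dots,x_{n-1})$. Accept the move to $(n^*,x^* )$ with the between-models acceptance probability displayed in the claim. *)

(* Defs.v *)
From HB Require Import structures.
From mathcomp Require Import all_boot all_order all_algebra.
From mathcomp Require Import all_classical all_reals all_analysis.

Set Implicit Arguments.
Unset Strict Implicit.
Unset Printing Implicit Defensive.

Import Order.TTheory GRing.Theory Num.Theory.

Local Open Scope ring_scope.

(* A dataset is a nonempty sequence of records; the added or removed record
   may sit at any position.  The empty sequence is not a dataset, so it is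
   nobody's neighbor. *)
Definition adds_one (X : Type) (x x' : seq X) : Prop :=
  exists (u v : seq X) (a : X), x = u ++ v /\ x' = u ++ a :: v.

Definition unbounded_neighbors (X : Type) (x x' : seq X) : Prop :=
  [/\ (0 < size x)%N, (0 < size x')%N & adds_one x x' \/ adds_one x' x].

(* The neighboring relation seen by a mechanism that depends on the dataset
   only through its size. *)
Definition size_neighbors (n n' : nat) : Prop :=
  [/\ (0 < n)%N, (0 < n')%N & n' = n.+1 \/ n = n'.+1].

(* [p y x] is the density p(y | x) of the output y on input x. *)
Definition density_dp (R : realType) (D Y : Type) (neighbors : D -> D -> Prop)
    (eps : R) (p : Y -> D -> R) : Prop :=
  forall (y : Y) (x x' : D), neighbors x x' -> p y x <= expR eps * p y x'.

Definition is_density (R : realType) (d : measure_display)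
    (Y : measurableType d) (mu : {measure set Y -> \bar R}) (f : Y -> R) : Prop :=
  [/\ measurable_fun setT f, forall y, 0 <= f y
    & (\int[mu]_y (f y)%:E)%E = 1%E].

(* Theta: parameters; X: records; S: outputs s; N: outputs n_dp; V: the values
   of the per-record summary t.  [size_prior] need not be summable. *)
Record model (R : realType) (dT dX dS dN : measure_display)
    (Theta : measurableType dT) (X : measurableType dX)
    (S : measurableType dS) (N : measurableType dN) (V : nmodType) := Model {
  theta_prior : probability Theta R;
  size_prior : nat -> R;
  size_prior_ge0 : forall n : nat, (0 < n)%N -> 0 <= size_prior n;
  record_law : R.-pker Theta ~> X;
  s_base : {measure set S -> \bar R};
  g : S -> V -> R;
  t : S -> X -> V;
  g_density : forall x : seq X, (0 < size x)%N ->
    is_density s_base (fun s => g s (\sum_(a <- x) t s a));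
  ndp_base : {measure set N -> \bar R};
  ndp_mech : N -> nat -> R;
  ndp_density : forall n : nat, (0 < n)%N ->
    is_density ndp_base (fun y => ndp_mech y n)
}.

Section Algorithm.
Context (R : realType) (dT dX dS dN : measure_display)
  (Theta : measurableType dT) (X : measurableType dX)
  (S : measurableType dS) (N : measurableType dN) (V : nmodType).
Variable M : model R Theta X S N V.

Definition s_mech (s : S) (x : seq X) : R := g M s (\sum_(a <- x) t M s a).

Definition flat_size_prior : Prop :=
  exists2 c : R, 0 < c & forall n : nat, (0 < n)%N -> size_prior M n = c.

Definition replace_record (n : nat) (x : n.-tuple X) (i : 'I_n) (a : X) :
    n.-tuple X :=
  [tuple (if j == i then a else tnth x j) | j < n].

Definition within_acceptance (s : S) (n : nat) (x x' : n.-tuple X) : R :=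
  Num.min 1 (s_mech s x' / s_mech s x).

(* [size_jump n' n] is q(n' | n). *)
Definition size_jump (n' n : nat) : R :=
  if n == 1%N then (if n' == 2%N then 1 else 0)
  else if (1 < n)%N && ((n' == n.+1) || (n == n'.+1)) then 2^-1
  else 0.

(* The moves (n, x) -> (n', x') that can be proposed, for some value of the
   record drawn when n' = n + 1. *)
Definition between_proposal (n : nat) (x : n.-tuple X)
    (n' : nat) (x' : n'.-tuple X) : Prop :=
  [/\ 0 < size_jump n' n,
      n' = n.+1 -> exists a : X, tval x' = rcons x a
    & n = n'.+1 -> tval x' = take n' x].

Definition between_acceptance (s : S) (ndp : N) (n : nat) (x : n.-tuple X)
    (n' : nat) (x' : n'.-tuple X) : R :=
  Num.min 1
    ((size_prior M n' * s_mech s x' * ndp_mech M ndp n' * size_jump n n')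
     / (size_prior M n * s_mech s x * ndp_mech M ndp n * size_jump n' n)).

End Algorithm.

(* Main.v *)
(* Replacing one record is an addition followed by a removal: inserting the new
   record before removing the old one keeps the intermediate dataset nonempty
   even when n = 1, so the likelihood drops by at most exp(- 2 eps_s).  A
   between-models move changes x and n by one neighbor step each, the flat prior
   cancels, and the proposal ratio is at least 1, except from n = 1, where it is
   1/2.  The bounds also need eps >= 0 because of the min with 1; this follows
   from applying the DP inequality back and forth between two neighbors of
   positive density. *)
Require Import Defs.
From HB Require Import structures.
From mathcomp Require Import all_boot all_order all_algebra.
From mathcomp Require Import all_classical all_reals all_analysis.
From mathcomp Require Import zify ring lra.

Set Implicit Arguments.
Unset Strict Implicit.
Unset Printing Implicit Defensive.

Import Order.TTheory GRing.Theory Num.Theory.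

Local Open Scope ring_scope.

Lemma unbounded_neighbors_sym (X : Type) (x x' : seq X) :
  unbounded_neighbors x x' -> unbounded_neighbors x' x.
Proof. by move=> [x0 x'0 [xx'|x'x]]; split=> //; [right|left]. Qed.

Lemma size_neighbors_sym (n n' : nat) :
  size_neighbors n n' -> size_neighbors n' n.
Proof. by move=> [n0 n'0 [->|->]]; split=> //; [right|left]. Qed.

Lemma unbounded_neighbors_insert (X : Type) (u v : seq X) (a : X) :
  (0 < size (u ++ v))%N -> unbounded_neighbors (u ++ v) (u ++ a :: v).
Proof.
move=> uv0; split=> //; first by rewrite size_cat /= addnS.
by left; exists u, v, a.
Qed.

Lemma unbounded_neighbors_rcons (X : Type) (x : seq X) (a : X) :
  (0 < size x)%N -> unbounded_neighbors x (rcons x a).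
Proof.
by move=> x0; rewrite -cats1 -{1}[x]cats0; apply: unbounded_neighbors_insert;
  rewrite cats0.
Qed.

Lemma density_dp_ge (R : realType) (D Y : Type) (nb : D -> D -> Prop) (eps : R)
    (p : Y -> D -> R) (y : Y) (x x' : D) :
  density_dp nb eps p -> nb x x' -> expR (- eps) * p y x <= p y x'.
Proof.
move=> dp xx'; rewrite -(ler_pM2l (expR_gt0 eps)) mulrA -expRD subrr expR0 mul1r.
exact: dp.
Qed.

Lemma density_dp_eps_ge0 (R : realType) (D Y : Type) (nb : D -> D -> Prop)
    (eps : R) (p : Y -> D -> R) (y : Y) (x x' : D) :
  density_dp nb eps p -> nb x x' -> nb x' x -> 0 < p y x -> 0 <= eps.
Proof.
move=> dp xx' x'x px.
have : p y x <= expR eps * (expR eps * p y x).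
  by rewrite (le_trans (dp y _ _ xx'))// ler_pM2l ?expR_gt0//; exact: dp.
by rewrite mulrA -expRD -[leLHS]mul1r ler_pM2r// -expR0 ler_expR; lra.
Qed.

(** Puts the replacement in the prefix-record-suffix form used by [adds_one], so that swapping a
    record can be read as insertions at a common position. *)
Lemma tval_replace_record (d : measure_display) (X : measurableType d) (n : nat)
    (x : n.-tuple X) (i : 'I_n) (a : X) :
  tval (replace_record x i a) = take i x ++ a :: drop i.+1 x.
Proof.
apply: (@eq_from_nth _ a) => [|k].
  by rewrite size_tuple size_cat /= size_take size_drop size_tuple ltn_ord /=; have := ltn_ord i; lia.
rewrite size_tuple => kn; rewrite -[k]/(val (Ordinal kn)) -tnth_nth tnth_mktuple.
rewrite nth_cat size_take size_tuple ltn_ord -val_eqE /=.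
have [ki|ik|->] := ltngtP k i; last by rewrite subnn.
  by rewrite nth_take// (tnth_nth a).
(* Past position [i], the offset [k - i] is a successor: one step skips the inserted [a], the rest
   indexes into the suffix. *)
rewrite -(subnSK ik) /= nth_drop (tnth_nth a) /=; congr nth; lia.
Qed.

Lemma size_jump_gt0 (R : realType) (n n' : nat) :
  (0 < n)%N -> 0 < size_jump R n' n -> size_neighbors n n'.
Proof.
rewrite /size_jump; have [->|n1] := eqVneq n 1%N => n0.
  by case: eqVneq => [->|]; rewrite ?ltxx// => _; split=> //; left.
case: ifP => [/andP[n2 /orP[/eqP nn'|/eqP nn']] _|_]; last by rewrite ltxx.
  by split=> //; [lia|left].
by split=> //; [lia|right].
Qed.

(** Away from size 1 the forward jump has probability 1/2, while the reverse jump has 1/2, or 1 if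
    it starts from size 1, where growth is forced. *)
Lemma size_jump_ratio_ge1 (R : realType) (n n' : nat) :
  (1 < n)%N -> 0 < size_jump R n' n -> 1 <= size_jump R n n' / size_jump R n' n.
Proof.
move=> n1 /[dup] q0 /(size_jump_gt0 (ltnW n1))[_ n'0 nn'].
have -> : size_jump R n' n = 2^-1.
  by rewrite /size_jump gtn_eqF// n1; case: nn' => ->; rewrite eqxx ?orbT.
rewrite /size_jump; have [n'1|n'1] := eqVneq n' 1%N.
  by have -> : n = 2%N by [lia]; rewrite eqxx; lra.
rewrite ifT; first by lra.
by apply/andP; split; [lia|case: nn' => ->; rewrite eqxx ?orbT].
Qed.

Lemma between_proposal_neighbors (R : realType) (d : measure_display)
    (X : measurableType d) (n n' : nat) (x : n.-tuple X) (x' : n'.-tuple X) :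
  (0 < n)%N -> between_proposal R x x' ->
  unbounded_neighbors (tval x) (tval x') /\ size_neighbors n n'.
Proof.
move=> n0 [/(size_jump_gt0 n0) nn' birth death]; split=> //.
have [_ n'0 [/birth[a ->]|/[dup] nE /death x'E]] := nn'.
  by apply: unbounded_neighbors_rcons; rewrite size_tuple.
(* [nth] needs a default record; the nonempty [x] supplies one. *)
have [a _] : exists a : X, a \in tval x.
  have : (0 < size x)%N by rewrite size_tuple.
  by case: (tval x) => // a l _; exists a; rewrite mem_head.
apply: unbounded_neighbors_sym.
(* A removal is an append read backwards: [x] is [x'] followed by its own last record. *)
have -> : tval x = rcons (tval x') (nth a x n').
  by rewrite x'E -take_nth ?size_tuple ?nE// take_oversize// size_tuple nE.
by apply: unbounded_neighbors_rcons; rewrite size_tuple.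
Qed.

(** The factor [k] lets one estimate serve both bounds: 1 for [2 <= n], and 1/2 for the jump from 1
    to 2. *)
Lemma between_acceptance_ge (R : realType) (dT dX dS dN : measure_display)
    (Theta : measurableType dT) (X : measurableType dX)
    (S : measurableType dS) (N : measurableType dN) (V : nmodType)
    (M : model R Theta X S N V) (eps_s eps_n k : R) (s : S) (ndp : N)
    (n : nat) (x : n.-tuple X) (n' : nat) (x' : n'.-tuple X) :
  density_dp (@unbounded_neighbors X) eps_s (s_mech M) ->
  density_dp size_neighbors eps_n (ndp_mech M) ->
  flat_size_prior M -> (0 < n)%N ->
  0 < s_mech M s x -> 0 < ndp_mech M ndp n -> between_proposal R x x' ->
  0 <= k <= 1 -> k <= size_jump R n n' / size_jump R n' n ->
  k * expR (- (eps_s + eps_n)) <= between_acceptance M s ndp x x'.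
Proof.
move=> s_dp n_dp [c c0 flat] n0 sx nx prop /andP[k0 k1] kq.
have [xx' nn'] := between_proposal_neighbors n0 prop.
have [_ n'0 _] := nn'; have [q0 _ _] := prop.
have es0 := density_dp_eps_ge0 s_dp xx' (unbounded_neighbors_sym xx') sx.
have en0 := density_dp_eps_ge0 n_dp nn' (size_neighbors_sym nn') nx.
(* Against the 1 in the minimum, [k <= 1] and the nonnegativity of both epsilons suffice. *)
rewrite /between_acceptance !flat// le_min; apply/andP; split.
  by rewrite mulr_ile1 ?expR_ge0// -expR0 ler_expR; lra.
(* The flat prior constant [c] cancels, leaving the proposal ratio and one likelihood ratio per
   mechanism, each bounded separately. *)
have -> : c * s_mech M s x' * ndp_mech M ndp n' * size_jump R n n'
    / (c * s_mech M s x * ndp_mech M ndp n * size_jump R n' n)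
  = size_jump R n n' / size_jump R n' n
    * ((s_mech M s x' / s_mech M s x) * (ndp_mech M ndp n' / ndp_mech M ndp n)).
  by field; rewrite !gt_eqF.
rewrite opprD expRD; apply: ler_pM => //.
apply: ler_pM; rewrite ?expR_ge0// ler_pdivlMr//.
  exact: density_dp_ge s_dp xx'.
exact: density_dp_ge n_dp nn'.
Qed.

Theorem proposition5p1 (R : realType) (dT dX dS dN : measure_display)
    (Theta : measurableType dT) (X : measurableType dX)
    (S : measurableType dS) (N : measurableType dN) (V : nmodType)
    (M : model R Theta X S N V) (eps_s eps_n : R)
    (s_dp : density_dp (@unbounded_neighbors X) eps_s (s_mech M))
    (n_dp : density_dp size_neighbors eps_n (ndp_mech M))
    (s : S) (ndp : N) :
  (forall (n : nat) (x : n.-tuple X) (i : 'I_n) (a : X),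
      0 < s_mech M s x ->
      expR (- (2 * eps_s)) <= within_acceptance M s x (replace_record x i a))
  /\
  (flat_size_prior M ->
   forall (n : nat) (x : n.-tuple X) (n' : nat) (x' : n'.-tuple X),
      (0 < n)%N -> 0 < s_mech M s x -> 0 < ndp_mech M ndp n ->
      between_proposal R x x' ->
      ((2 <= n)%N ->
         expR (- (eps_s + eps_n)) <= between_acceptance M s ndp x x') /\
      (n = 1%N -> n' = 2%N ->
         2^-1 * expR (- (eps_s + eps_n)) <= between_acceptance M s ndp x x')).
Proof.
split=> [n x i a sx|flat n x n' x' n0 sx nx prop]; last first.
  have [q0 _ _] := prop; split=> [n2|nE n'E].
    rewrite -[leLHS]mul1r; apply: between_acceptance_ge => //.
      by rewrite ler01 lexx.
    exact: size_jump_ratio_ge1.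
  apply: between_acceptance_ge => //; first by lra.
  (* Here q(1|2) = 1/2 and q(2|1) = 1. *)
  by rewrite nE n'E /size_jump /=; lra.
set b := tnth x i; pose u := take i x; pose v := drop i.+1 x.
have xE : tval x = u ++ b :: v.
  by rewrite /u /v /b (tnth_nth a) -drop_nth ?size_tuple// cat_take_drop.
have add_a : unbounded_neighbors (u ++ b :: v) (u ++ a :: b :: v).
  by apply: unbounded_neighbors_insert; rewrite size_cat addnS.
have drop_b : unbounded_neighbors (u ++ a :: b :: v) (u ++ a :: v).
  (* Absorbing [a] into the prefix makes [b] the inserted record. *)
  apply: unbounded_neighbors_sym; rewrite -2!(cat_rcons a).
  by apply: unbounded_neighbors_insert; rewrite size_cat size_rcons.
rewrite /within_acceptance tval_replace_record -/u -/v; rewrite xE in sx *.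
have es0 := density_dp_eps_ge0 s_dp add_a (unbounded_neighbors_sym add_a) sx.
rewrite le_min; apply/andP; split; first by rewrite -[leRHS]expR0 ler_expR; lra.
(* One factor exp(-eps_s) pays for each of the two neighbor steps through [u ++ a :: b :: v]. *)
rewrite ler_pdivlMr// mulr_natl mulr2n opprD expRD -mulrA.
rewrite (le_trans _ (density_dp_ge s s_dp drop_b))//.
by rewrite ler_pM2l ?expR_gt0//; exact: density_dp_ge s_dp add_a.
Qed.
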